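(* For every field $F$ of finite characteristic $p$, there exists a torsion-free atomic monoid $M$ of rank $2$ such that the monoid algebra $F[x;M]$ is not atomic.
   Context: All monoids are commutative and cancellative, written additively. $M$ is torsion-free if $nx = ny$ for some $n \in \mathbb{N}$ implies $x = y$. An atom of $M$ is a non-invertible element $a$ such that $a = x+y$ implies $x$ or $y$ is invertible; $M$ is atomic if every non-invertible element is a finite sum of atoms. The rank of $M$ is $\dim_{\mathbb{Q}} \mathbb{Q} \otimes_{\mathbb{Z}} \mathsf{gp}(M)$, where $\mathsf{gp}(M)$ is the Grothendieck group. $F[x;M]$ is the ring of finitely supported functions $M \to F$ (written $\sum_s f(s)x^s$) with convolution product, an integral domain; it is atomic if every nonzero nonunit is a finite product of irreducible elements. *)

(* Defs.v *)
From HB Require Import structures.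
From mathcomp Require Import all_boot all_order all_algebra.
From mathcomp Require Import finmap.
Set Implicit Arguments. Unset Strict Implicit. Unset Printing Implicit Defensive.
Import Order.TTheory GRing.Theory Num.Theory.
Local Open Scope ring_scope.


Definition mcancellative (M : nmodType) : Prop :=
  forall x y z : M, x + y = x + z -> y = z.

Definition mtorsion_free (M : nmodType) : Prop :=
  forall (n : nat) (x y : M), (0 < n)%N -> x *+ n = y *+ n -> x = y.

Definition minvertible (M : nmodType) (x : M) : Prop := exists y : M, x + y = 0.

Definition matom (M : nmodType) (a : M) : Prop :=
  ~ minvertible a /\
  forall x y : M, a = x + y -> minvertible x \/ minvertible y.

Definition matomic (M : nmodType) : Prop :=
  forall x : M, ~ minvertible x ->
    exists s : seq M, (forall a, a \in s -> matom a) /\ x = \sum_(a <- s) a.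

(* ---------- Rank ----------
   An element of the Grothendieck group gp(M) is a formal difference a - b,
   represented by the pair (a, b).  A family v_1,...,v_k of elements of gp(M)
   is Z-linearly independent iff  sum_i (m_i - n_i) (a_i - b_i) = 0  (with
   m_i, n_i natural numbers) forces m = n; for cancellative M the equation
   holds in gp(M) iff it holds in M after moving negative terms across. *)
Definition gp_indep (M : nmodType) (k : nat) (v : 'I_k -> M * M) : Prop :=
  forall m n : 'I_k -> nat,
    \sum_(i < k) ((v i).1 *+ m i + (v i).2 *+ n i)
      = \sum_(i < k) ((v i).2 *+ m i + (v i).1 *+ n i) ->
    forall i, m i = n i.

(* rank M = dim_Q (Q (x)_Z gp(M)) = maximal size of a Z-independent family
   in gp(M); rank M = r means some family of size r is independent and no
   family of size r+1 is. *)
Definition has_rank (M : nmodType) (r : nat) : Prop :=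
  (exists v : 'I_r -> M * M, gp_indep v) /\
  (forall v : 'I_r.+1 -> M * M, ~ gp_indep v).

Definition malg (F : fieldType) (M : nmodType) := {fsfun M -> F with 0}.

Definition malg_mul (F : fieldType) (M : nmodType) (f g : malg F M) : malg F M :=
  [fsfun s in [fset (u + v)%R | u in finsupp f, v in finsupp g]%fset =>
     \sum_(u <- finsupp f) \sum_(v <- finsupp g)
        (if u + v == s then f u * g v else 0) | 0].

Definition malg_one (F : fieldType) (M : nmodType) : malg F M :=
  [fsfun s in [fset (0 : M)]%fset => (1 : F) | 0].

Definition malg_zero (F : fieldType) (M : nmodType) : malg F M :=
  [fsfun s in fset0%fset => (0 : F) | 0].

Definition malg_unit (F : fieldType) (M : nmodType) (f : malg F M) : Prop :=
  exists g : malg F M, malg_mul f g = malg_one F M.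

Definition malg_irreducible (F : fieldType) (M : nmodType) (f : malg F M) : Prop :=
  f <> malg_zero F M /\ ~ malg_unit f /\
  forall g h : malg F M, f = malg_mul g h -> malg_unit g \/ malg_unit h.

Definition malg_atomic (F : fieldType) (M : nmodType) : Prop :=
  forall f : malg F M, f <> malg_zero F M -> ~ malg_unit f ->
    exists s : seq (malg F M),
      (forall g, g \in s -> malg_irreducible g) /\
      f = foldr (@malg_mul F M) (malg_one F M) s.

(* Main.v *)
Require Import Defs.
From HB Require Import structures.
From mathcomp Require Import all_boot all_order all_algebra.
From mathcomp Require Import finmap.
From mathcomp Require Import qpoly boolp ring.
Set Implicit Arguments. Unset Strict Implicit. Unset Printing Implicit Defensive.
Import Order.TTheory GRing.Theory Num.Theory.
Import Pdiv.Idomain.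
Local Open Scope ring_scope.

(** Let G be the submonoid of the nonnegative rationals generated by the numbers
    1 / (q p^q), for q a prime other than p.  Each generator is an atom, because
    it is the only one whose q-adic valuation is negative; nevertheless
    1 / p^q = q * (1 / (q p^q)), so G contains 1 / p^k for every k.

    In M = G * G, of rank 2, put f_k = x^(1/p^k, 0) + x^(0, 1/p^k) - 1, so that
    f_k = (f_{k+1})^p by Frobenius.  If g divides f_0 in F[x; M], the exponents
    occurring in g and its cofactor have a common denominator N = m p^k with m
    prime to p, and replacing x^(1/N, 0), x^(0, 1/N) by X, Y turns g into a
    divisor of (Y^m + X^m - 1)^(p^k).  As Y^m + X^m - 1 is irreducible, g is
    c f_k^j = c f_{k+1}^(p j), hence a unit or reducible: f_0 has no irreducible
    divisor at all. *)

(** * The polynomials Y^m + X^m - 1 *)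

(** Over a domain, [%|] and [%=] hold up to nonzero scalars of [R]. Induction on [n]: either one
    factor [e] cancels, or [g] is coprime to [e] and Gauss's lemma lowers the exponent. *)
Lemma dvdp_exp_irreducible (R : idomainType) (e g : {poly R}) (n : nat) :
  irreducible_poly e -> g %| e ^+ n -> exists j, g %= e ^+ j.
Proof.
move=> irr_e; have e0 := irredp_neq0 irr_e.
elim: n g => [|n IHn] g.
  by move=> g1; exists 0%N; rewrite expr0 -size_poly_eq1 -dvdp1.
have [e_g|] := boolP (e %| g); last first.
  rewrite -irreducible_poly_coprime // coprimep_sym => cop_ge.
  by rewrite exprSr Gauss_dvdpl //; apply: IHn.
have /dvdpP [[c h] /= c0 def_g] := e_g.
have g_he : g %= h * e.
  by apply/eqpP; exists (c, 1); rewrite ?oner_eq0 ?c0 //= scale1r.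
rewrite (eqp_dvdl _ g_he) exprSr dvdp_mul2r // => /IHn [j h_ej].
by exists j.+1; rewrite (eqp_trans g_he) // exprSr eqp_mul2r.
Qed.

Lemma scale_polyI (R : idomainType) (c : R) :
  c != 0 -> injective ( *:%R c : {poly R} -> {poly R}).
Proof.
move=> c0 p q; rewrite -!mul_polyC; apply: mulfI.
by rewrite polyC_eq0.
Qed.

Section FermatCurve.

Variable F : fieldType.

(** The outer variable is Y and the inner one X, so that Y^m + X^m - 1 is monic in Y for positive
    [m]. *)
Definition fermat (m : nat) : {poly {poly F}} := 'X^m + ('X^m - 1)%:P.

Lemma size_fermat m : (0 < m)%N -> size (fermat m) = m.+1.
Proof.
by move=> m_gt0; rewrite size_polyDl size_polyXn // size_polyC; case: eqP.
Qed.

Lemma fermat_monic m : (0 < m)%N -> fermat m \is monic.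
Proof.
move=> m_gt0; rewrite monicE lead_coefDl ?lead_coefXn //.
by rewrite size_polyXn size_polyC; case: eqP.
Qed.

(** Frobenius is additive on F[X][Y] and, for the constant term, on F[X]. *)
Lemma fermat_pchar p m : p \in [pchar F] -> fermat (m * p) = fermat m ^+ p.
Proof.
move=> pF; have pP : p \in [pchar {poly F}] by rewrite pchar_poly.
have pPP : p \in [pchar {poly {poly F}}] by rewrite pchar_poly.
rewrite -(pFrobenius_autE pPP) /fermat (rmorphD (pFrobenius_aut pPP)) /=.
rewrite !pFrobenius_autE.
by rewrite -polyC_exp -(pFrobenius_autE pP ('X^m - 1)) (rmorphB (pFrobenius_aut pP)) /=
  pFrobenius_aut1 !pFrobenius_autE !exprM.
Qed.

Lemma fermat_pchar_exp p m k : p \in [pchar F] ->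
  fermat (m * p ^ k) = fermat m ^+ (p ^ k).
Proof.
move=> pF; elim: k => [|k IHk]; first by rewrite muln1 expr1.
by rewrite expnSr mulnA fermat_pchar // IHk exprM.
Qed.

(** Reduction modulo the prime X - 1 of F[X], with values in F[Y]. *)
Let ev1 : {poly {poly F}} -> {poly F} := map_poly (horner_eval 1).

Lemma ev1_eq0 q : ev1 q = 0 -> exists q', q = ('X - 1%:P) *: q'.
Proof.
move=> q0; exists (\poly_(i < size q) (q`_i %/ ('X - 1%:P))).
apply/polyP=> i; rewrite coefZ coef_poly; case: ltnP => [_|le_qi]; last first.
  by rewrite mulr0 nth_default.
rewrite mulrC Pdiv.Field.divpK // -root_factor_theorem /root.
by have /polyP/(_ i) := q0; rewrite coef_map coef0 => /eqP.
Qed.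

(** If [a] does not vanish at 0, it is coprime to X, hence to X^m, and so it divides 1. *)
Lemma root0_dvd_Xn (a b : {poly F}) (c : F) m :
  c != 0 -> a * b = c *: 'X^m -> size a != 1 -> root a 0.
Proof.
move=> c0 def_ab; apply: contraR; rewrite -coprimep_XsubC subr0 => cop.
rewrite -dvdp1 -(@Gauss_dvdpl _ _ ('X^m)) ?mul1r.
  by rewrite -(dvdpZr _ _ c0) -def_ab dvdp_mulIl.
by rewrite coprimep_expr // coprimep_sym.
Qed.

(* Eisenstein's criterion at the prime X - 1 of F[X], which divides X^m - 1
   exactly once. *)
Lemma fermat_factor m (c : {poly F}) (q r : {poly {poly F}}) :
  m%:R != 0 :> F -> c != 0 -> c *: fermat m = q * r ->
  size q = 1 \/ size r = 1.
Proof.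
move=> mF; have m_gt0 : (0 < m)%N by rewrite lt0n; apply: contraNneq mF => ->.
(* Induction on the size of [c] allows its factors X - 1 to be cancelled one by one. *)
have [n] := ubnP (size c); elim: n c q r => // n IHn c q r ltcn c0 def_qr.
have qr0 : q * r != 0.
  by rewrite -def_qr scale_poly_eq0 negb_or c0 -size_poly_eq0 size_fermat.
have [q0 r0] : q != 0 /\ r != 0 by apply/andP; rewrite -negb_or -mulf_eq0.
have Dev : ev1 q * ev1 r = c.[1] *: 'X^m.
  rewrite -rmorphM -def_qr; apply/polyP=> i; rewrite coef_map /= /horner_eval.
  rewrite !coefZ !coefD coefC !coefXn hornerM hornerD.
  case: (i == 0); rewrite ?hornerD ?hornerN ?hornerXn ?hornerC ?expr1n ?subrr ?addr0.
  - by case: eqP; rewrite ?hornerC.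
  - by case: eqP; rewrite ?hornerC.
(* If X - 1 divides [c], then [q] or [r] vanishes modulo X - 1, and one factor X - 1 cancels on both
   sides. *)
have [c1|c1] := boolP (root c 1).
  have X1 : 'X - 1%:P != 0 :> {poly F} by rewrite polyXsubC_eq0.
  have /factor_theorem [c' Dc] := c1.
  have c'0 : c' != 0 by apply: contraNneq c0; rewrite Dc => ->; rewrite mul0r.
  have ltc'n : (size c' < n)%N.
    by move: ltcn; rewrite Dc size_Mmonic ?monicXsubC // size_XsubC addn2.
  move: Dev; rewrite (eqP c1) scale0r => /eqP; rewrite mulf_eq0.
  case/orP=> /eqP /ev1_eq0 [s Ds].
  - have [] := IHn c' s r ltc'n c'0; last by right.
      by apply: (scale_polyI X1); rewrite scalerA mulrC -Dc def_qr Ds scalerAl.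
    by rewrite Ds size_scale //; left.
  - have [] := IHn c' q s ltc'n c'0; first 2 [by left].
      by apply: (scale_polyI X1); rewrite scalerA mulrC -Dc def_qr Ds scalerAr.
    by rewrite Ds size_scale //; right.
(* Now c(1) is nonzero, so the degrees in Y of the two factors add up to [m] both before and after
   reduction: neither degree drops. *)
have sz_qr : (size q + size r = m.+2)%N.
  rewrite -(size_fermat m_gt0) -(size_scale (fermat m) c0) def_qr size_mul //.
  by rewrite prednK // addn_gt0 size_poly_gt0 q0.
have sz_ev : (size (ev1 q) + size (ev1 r) = m.+2)%N.
  have D0 : ev1 q * ev1 r != 0.
    by rewrite Dev scale_poly_eq0 negb_or c1 monic_neq0 ?monicXn.
  move: (D0); rewrite mulf_eq0 negb_or => /andP [q1 r1].
  have := size_mul q1 r1; rewrite Dev size_scale // size_polyXn => ->.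
  by rewrite prednK // addn_gt0 size_poly_gt0 q1.
have [le_q le_r] : (size (ev1 q) <= size q /\ size (ev1 r) <= size r)%N.
  by split; apply: size_poly.
have Dq : size (ev1 q) = size q.
  apply/eqP; rewrite eqn_leq le_q -(leq_add2r (size r)) sz_qr -sz_ev.
  by rewrite leq_add2l.
have Dr : size (ev1 r) = size r.
  by apply/eqP; rewrite -(eqn_add2l (size q)) sz_qr -sz_ev Dq.
have [|q1] := eqVneq (size q) 1; first by left.
have [|r1] := eqVneq (size r) 1; first by right.
(* If neither factor is constant in Y, both reductions vanish at Y = 0: the constant terms of [q]
   and [r] vanish at X = 1. *)
have := root0_dvd_Xn c1 Dev; rewrite Dq => /(_ q1).
rewrite mulrC in Dev; have := root0_dvd_Xn c1 Dev; rewrite Dr => /(_ r1).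
rewrite /root !horner_coef0 !coef_map /= /horner_eval => /eqP r01 /eqP q01.
(* The product of these constant terms has derivative 0 at X = 1, whereas c (X^m - 1) has derivative
   m c(1) there. *)
have := congr1 (fun s : {poly {poly F}} => (s`_0)^`().[1]) def_qr.
rewrite /= coefZ coef0M !derivM !hornerD !hornerM r01 q01 mulr0 mul0r addr0.
rewrite coefD coefXn coefC /= ltn_eqF // add0r.
rewrite derivB derivXn derivC subr0 hornerMn !hornerE !expr1n subrr mulr0 add0r.
by move/eqP; rewrite mulf_eq0 (negPf mF) orbF [_ == 0](negPf c1).
Qed.

(** A divisor is one only up to a scalar of F[X]; this is the scalar [c] of [fermat_factor]. *)
Lemma fermat_irreducible m : m%:R != 0 :> F -> irreducible_poly (fermat m).
Proof.
move=> mF; have m_gt0 : (0 < m)%N by rewrite lt0n; apply: contraNneq mF => ->.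
split=> [|q q1]; first by rewrite size_fermat.
move=> /dvdpP [[c r] /= c0 Dcr].
have E0 := monic_neq0 (fermat_monic m_gt0).
have r0 : r != 0.
  apply: contraNneq c0 => r0; move/eqP: Dcr.
  by rewrite r0 mul0r scale_poly_eq0 (negPf E0) orbF.
have := fermat_factor mF c0 Dcr; case=> [/eqP|] // sz_r; last first.
  by rewrite sz_r in q1.
have /size_poly1P [a a0 Da] := sz_r.
rewrite eqp_sym; apply/eqpP; exists (c, a) => /=; first by rewrite c0.
by rewrite Dcr Da mul_polyC.
Qed.

(** Irreducibility determines [g] only up to scalars of F[X]. As [fermat m] is monic, the leading
    coefficients of [g] and [h] multiply to 1, so that of [g] lies in F. *)
Lemma dvd_fermat_exp m n (g h : {poly {poly F}}) :
  m%:R != 0 :> F -> g * h = fermat m ^+ n ->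
  exists c j, c != 0 /\ g = c%:P%:P * fermat m ^+ j.
Proof.
move=> mF Dgh; have m_gt0 : (0 < m)%N by rewrite lt0n; apply: contraNneq mF => ->.
have Em j : fermat m ^+ j \is monic by rewrite monic_exp // fermat_monic.
have g_dvd : g %| fermat m ^+ n by rewrite -Dgh dvdp_mulIl.
have [j /eqpP [[c1 c2] /= /andP[c10 c20] Dg]] :=
  dvdp_exp_irreducible (fermat_irreducible mF) g_dvd.
have lead1 : lead_coef g * lead_coef h = 1.
  by rewrite -lead_coefM Dgh (monicP (Em n)).
have : size (lead_coef g * lead_coef h) == 1 by rewrite lead1 size_poly1.
rewrite size_mul_eq1 => /andP [/size_poly1P [c c0 Dc] _].
have := congr1 lead_coef Dg; rewrite !lead_coefZ (monicP (Em j)) mulr1 => Dc2.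
exists c, j; split=> //; apply: (scale_polyI c10).
by rewrite Dg -Dc2 -scalerA Dc mul_polyC.
Qed.

End FermatCurve.
(** * The monoid generated by the 1 / (q p^q) *)

Definition grams_index (p : nat) : pred nat := [pred q | prime q && (q != p)].

Definition grams_gen (p q : nat) : rat := (q * p ^ q)%:R^-1.

Definition grams_pred (p : nat) : {pred rat} := fun x =>
  `[< exists2 s, all (grams_index p) s & x = \sum_(q <- s) grams_gen p q >].

Lemma grams_predP p x :
  reflect (exists2 s, all (grams_index p) s & x = \sum_(q <- s) grams_gen p q)
          (x \in grams_pred p).
Proof. exact: asboolP. Qed.

Lemma grams_pred_closed p : GRing.nmod_closed (grams_pred p).
Proof.
split; first by apply/grams_predP; exists [::]; rewrite ?big_nil.
move=> _ _ /grams_predP [s sP ->] /grams_predP [t tP ->].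
by apply/grams_predP; exists (s ++ t); rewrite ?all_cat ?sP // big_cat.
Qed.

Record grams (p : nat) := Grams { grams_val : rat; _ : grams_val \in grams_pred p }.

HB.instance Definition _ p := [isSub for @grams_val p].
HB.instance Definition _ p := [Choice of grams p by <:].
HB.instance Definition _ p :=
  GRing.SubChoice_isSubNmodule.Build rat (grams_pred p) (grams p)
    (grams_pred_closed p).

Section Grams.

Variable p : nat.
Hypothesis p_pr : prime p.
Notation G := (grams p).
Notation M := (grams p * grams p)%type.

Lemma grams_gen_gt0 q : grams_index p q -> 0 < grams_gen p q.
Proof.
move=> /andP [q_pr _].
by rewrite invr_gt0 ltr0n muln_gt0 expn_gt0 !prime_gt0.
Qed.

Lemma grams_sum_ge0 s : all (grams_index p) s -> 0 <= \sum_(q <- s) grams_gen p q.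
Proof.
move=> /allP sP; rewrite big_seq; apply: sumr_ge0 => q /sP qP.
exact/ltW/grams_gen_gt0.
Qed.

Lemma grams_sum_eq0 s :
  all (grams_index p) s -> \sum_(q <- s) grams_gen p q = 0 -> s = [::].
Proof.
case: s => // q s /= /andP [qP sP]; rewrite big_cons => /eqP.
by rewrite gt_eqF // ltr_pwDl ?grams_gen_gt0 ?grams_sum_ge0.
Qed.

(** The product [d] of the denominators [r * p ^ r] clears the sum, and the prime [q] differs from
    [p] and from each [r]. In other words, the sum is q-integral. *)
Lemma grams_sum_denom q s : grams_index p q -> all (grams_index p) s -> q \notin s ->
  exists d a : nat, ~~ (q %| d)%N /\ d%:R * (\sum_(r <- s) grams_gen p r) = a%:R.
Proof.
move=> /andP [q_pr q_p]; elim: s => [|r s IHs] /=.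
  by exists 1%N, 0%N; rewrite big_nil mulr0 dvdn1; case: eqP q_pr => // ->.
move=> /andP [rP /IHs sP]; rewrite inE negb_or => /andP [q_r /sP [d [a [qd Dda]]]].
have r0 := grams_gen_gt0 rP; case/andP: rP => r_pr _.
exists (d * (r * p ^ r))%N, (d + r * p ^ r * a)%N; split.
  rewrite !Euclid_dvdM // !negb_or qd dvdn_prime2 // q_r.
  by rewrite Euclid_dvdX // dvdn_prime2 // (negPf q_p).
rewrite big_cons mulrDr natrD; congr (_ + _).
  by rewrite natrM mulfK // -invr_eq0 gt_eqF.
by rewrite natrM mulrAC Dda -natrM mulnC.
Qed.

(** If [q] occurs in [s], the other terms are positive with sum 0, so there are none. Otherwise the
    sum is q-integral, which [grams_gen p q] is not. *)
Lemma grams_gen_atomic q s : grams_index p q -> all (grams_index p) s ->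
  \sum_(r <- s) grams_gen p r = grams_gen p q -> size s = 1%N.
Proof.
move=> qP sP; have [q_s|q_s] := boolP (q \in s).
  rewrite (big_rem q) //= => /(canRL (addKr _)); rewrite addNr => /grams_sum_eq0 s0.
  have := size_rem q_s; rewrite s0 /=; last first.
    by apply/allP=> r /mem_rem; apply: (allP sP).
  by case: (s) q_s => // a [].
have [d [a [qd Dda]]] := grams_sum_denom qP sP q_s; move=> Dq; case/negP: qd.
have n0 : (q * p ^ q)%:R != 0 :> rat by rewrite -invr_eq0 gt_eqF ?grams_gen_gt0.
move/eqP: Dda; rewrite Dq -(can_eq (mulfK n0)) divfK // -natrM eqr_nat => /eqP ->.
by rewrite mulnCA dvdn_mulr.
Qed.

Lemma grams_ge0 (x : G) : 0 <= val x.
Proof. by case: x => x /= /grams_predP [s sP ->]; apply: grams_sum_ge0. Qed.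

Lemma grams_reduced (x y : G) : x + y = 0 -> x = 0.
Proof.
move=> /(congr1 val); rewrite raddfD raddf0 /= => /eqP.
rewrite paddr_eq0 ?grams_ge0 // => /andP [/eqP x0 _].
by apply: val_inj; rewrite raddf0.
Qed.

Lemma grams_invertible (u : M) : minvertible u <-> u = 0.
Proof.
split=> [[[x y]]|->]; last by exists 0; rewrite addr0.
case: u => a b ab.
have /grams_reduced -> : a + x = 0 := congr1 fst ab.
by have /grams_reduced -> : b + y = 0 := congr1 snd ab.
Qed.

Lemma grams_gen_in q : grams_index p q -> grams_gen p q \in grams_pred p.
Proof.
by move=> qP; apply/grams_predP; exists [:: q]; rewrite ?big_seq1 //= qP.
Qed.

(* Junk value 0 if q is not an index. *)
Definition grams_atom q : G := insubd 0 (grams_gen p q).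

Lemma grams_atomE q : grams_index p q -> val (grams_atom q) = grams_gen p q.
Proof. by move=> qP; rewrite val_insubd grams_gen_in. Qed.

(** Concatenating expressions of [x] and [y] in the generators gives one of length 1, so one of the
    two is empty. *)
Lemma grams_atomP q x y :
  grams_index p q -> grams_atom q = x + y -> x = 0 \/ y = 0.
Proof.
move=> qP /(congr1 val); rewrite raddfD grams_atomE //=.
have [/grams_predP [s sP Dx] /grams_predP [t tP Dy]] := (valP x, valP y).
rewrite [val x]Dx [val y]Dy -big_cat => /esym /grams_gen_atomic.
rewrite all_cat sP tP => /(_ qP isT); rewrite size_cat.
case: s Dx {sP} => [|a s] Dx; first by left; apply: val_inj; rewrite [LHS]Dx big_nil.
case: t Dy {tP} => [|b t] Dy; first by right; apply: val_inj; rewrite [LHS]Dy big_nil.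
by rewrite /= addSn addnS.
Qed.

Lemma grams_atom_neq0 q : grams_index p q -> grams_atom q <> 0.
Proof.
move=> qP /(congr1 val); rewrite grams_atomE // raddf0 => /eqP.
by rewrite gt_eqF ?grams_gen_gt0.
Qed.

Lemma grams_atom_sum (x : G) :
  exists2 s, all (grams_index p) s & x = \sum_(q <- s) grams_atom q.
Proof.
have /grams_predP [s sP Dx] := valP x; exists s => //.
apply: val_inj; rewrite raddf_sum /= [LHS]Dx [LHS]big_seq [RHS]big_seq.
by apply: eq_bigr => q /(allP sP) /grams_atomE.
Qed.

(** In a decomposition the second components sum to 0, so both vanish; [grams_atomP] settles the
    first ones. *)
Lemma grams2_atom_l q : grams_index p q -> matom ((grams_atom q, 0) : M).
Proof.
move=> qP; split=> [/grams_invertible D|].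
  exact: grams_atom_neq0 qP (congr1 fst D).
move=> [x1 x2] [y1 y2] xy.
have /(grams_atomP qP) xy1 : grams_atom q = x1 + y1 := congr1 fst xy.
have xy2 : x2 + y2 = 0 := esym (congr1 snd xy).
have x20 := grams_reduced xy2; rewrite addrC in xy2; have y20 := grams_reduced xy2.
by case: xy1 => ->; [left|right]; apply/grams_invertible; rewrite ?x20 ?y20.
Qed.

Lemma grams2_atom_r q : grams_index p q -> matom ((0, grams_atom q) : M).
Proof.
move=> qP; split=> [/grams_invertible D|].
  exact: grams_atom_neq0 qP (congr1 snd D).
move=> [x1 x2] [y1 y2] xy.
have /(grams_atomP qP) xy1 : grams_atom q = x2 + y2 := congr1 snd xy.
have xy2 : x1 + y1 = 0 := esym (congr1 fst xy).
have x20 := grams_reduced xy2; rewrite addrC in xy2; have y20 := grams_reduced xy2.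
by case: xy1 => ->; [left|right]; apply/grams_invertible; rewrite ?x20 ?y20.
Qed.

Lemma grams2_atomic : matomic M.
Proof.
move=> [x y] _; have [s sP Dx] := grams_atom_sum x.
have [t tP Dy] := grams_atom_sum y.
exists ([seq (grams_atom q, 0) | q <- s] ++ [seq (0, grams_atom q) | q <- t]).
split=> [a|]; first rewrite mem_cat => /orP [] /mapP [q qs ->].
- exact/grams2_atom_l/(allP sP).
- exact/grams2_atom_r/(allP tP).
rewrite big_cat !big_map /= [LHS](_ : _ = (x, 0) + (0, y)); last first.
  by congr pair; rewrite /= ?addr0 ?add0r.
have inl (r : seq nat) (f : nat -> G) :
    (\sum_(q <- r) f q, 0) = \sum_(q <- r) ((f q, 0) : M).
  elim: r => [|q r IHr]; rewrite ?big_nil // !big_cons -IHr.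
  by congr pair; rewrite /= addr0.
have inr (r : seq nat) (f : nat -> G) :
    (0, \sum_(q <- r) f q) = \sum_(q <- r) ((0, f q) : M).
  elim: r => [|q r IHr]; rewrite ?big_nil // !big_cons -IHr.
  by congr pair; rewrite /= addr0.
by rewrite Dx Dy inl inr.
Qed.

Lemma grams_pinv k : (p ^ k)%:R^-1 \in grams_pred p.
Proof.
(* Being above [p] makes [q] an index; being above [k], it lets 1/p^k be written as q p^(q-k) copies
   of 1/(q p^q). *)
have [q lt_q q_pr] := prime_above (maxn k p).
move: lt_q; rewrite gtn_max => /andP [lt_kq lt_pq].
apply/grams_predP; exists (nseq (q * p ^ (q - k)) q).
  by apply/allP=> r /nseqP [-> _]; apply/andP; rewrite q_pr gtn_eqF.
have pX0 n : (p ^ n)%:R != 0 :> rat by rewrite pnatr_eq0 -lt0n expn_gt0 prime_gt0.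
have q0 : q%:R != 0 :> rat by rewrite pnatr_eq0 -lt0n prime_gt0.
rewrite big_nseq iter_addr_0 -[RHS]mulr_natr /grams_gen.
rewrite -[in X in (q * p ^ X)%N](subnK (ltnW lt_kq)) expnD mulnA natrM invfM.
by rewrite mulrAC mulVf ?mul1r // natrM mulf_neq0.
Qed.

Definition pinv k : G := Grams (grams_pinv k).

(** * Embedding of the monoid in Q^2: cancellation, torsion-freeness and rank *)

Definition coord (j : 'I_2) (u : M) : rat := if j == 0 then val u.1 else val u.2.

Lemma coordD j u v : coord j (u + v) = coord j u + coord j v.
Proof. by rewrite /coord; case: ifP; rewrite raddfD. Qed.

Lemma coord0 j : coord j 0 = 0.
Proof. by rewrite /coord; case: ifP; rewrite raddf0. Qed.

Lemma coordMn j u n : coord j (u *+ n) = coord j u *+ n.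
Proof. by elim: n => [|n IHn]; rewrite ?coord0 // !mulrS coordD IHn. Qed.

Lemma coord_inj u v : (forall j, coord j u = coord j v) -> u = v.
Proof.
case: u v => [a b] [c d] uv; congr pair; apply: val_inj.
  exact: (uv 0).
exact: (uv 1).
Qed.

Lemma coord_ge0 j u : 0 <= coord j u.
Proof. by rewrite /coord; case: ifP; rewrite grams_ge0. Qed.

Lemma grams2_cancellative : mcancellative M.
Proof.
move=> x y z xyz; apply: coord_inj => j; apply: (addrI (coord j x)).
by rewrite -!coordD xyz.
Qed.

Lemma grams2_torsion_free : mtorsion_free M.
Proof.
move=> n x y n_gt0 xy; apply: coord_inj => j.
apply: (pmulrnI n_gt0).
by rewrite -!coordMn xy.
Qed.

(** The product of all denominators works. It serves to clear linear relations and, later, the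
    exponents in a finite support. *)
Lemma rat_common_denom (I : finType) (u : I -> rat) :
  exists2 d : nat, (0 < d)%N & forall i, exists z : int, d%:R * u i = z%:~R.
Proof.
exists (\prod_i `|denq (u i)|)%N.
  by rewrite prodn_gt0 // => i; rewrite absz_gt0 denq_neq0.
move=> i; exists ((\prod_(j | j != i) `|denq (u j)|)%N%:Z * numq (u i)).
rewrite (bigD1 i) //= natrM mulrAC [_ * u i]mulrC (pmulrn _ `|denq (u i)|).
by rewrite absz_denq -numqE rmorphM mulrC.
Qed.

Lemma grams2_rank : has_rank M 2.
Proof.
split.
  (* [pinv 0] is the number 1, so these are the two unit vectors. *)
  exists (fun i => (if i == 0 then (pinv 0, 0) else (0, pinv 0), 0)) => m n.
  under eq_bigr do rewrite mul0rn addr0; under [RHS]eq_bigr do rewrite mul0rn add0r.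
  rewrite !big_ord_recl !big_ord0 /= !addr0 => mn i.
  apply/eqP; rewrite -(eqr_nat rat); have := congr1 (coord i) mn.
  rewrite !coordD !coordMn /coord /= expn0 invr1.
  by case: (unliftP ord0 i) => [j ->|->]; rewrite ?ord1 /= !mul0rn ?add0r ?addr0 => ->.
move=> v v_indep.
(* Row [i] is the image of [v i] in Q^2; three rows of length 2 satisfy a nontrivial rational
   relation [u]. *)
pose A : 'M[rat]_(3, 2) := \matrix_(i, j) (coord j (v i).1 - coord j (v i).2).
have [u u0 uA] : exists2 u : 'rV_3, u != 0 & u *m A = 0.
  have : kermx A != 0.
    by rewrite kermx_eq0 /row_free neq_ltn (leq_ltn_trans (rank_leq_col A)).
  by case/rowV0Pn=> u /sub_kermxP uA u0; exists u.
have [d d_gt0 Dz] := rat_common_denom (u 0).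
have [z Dzi] := choice Dz.
(* The integral coefficients are split into positive and negative parts, as [gp_indep] requires.
   [Negz n] encodes -(n + 1), whence [n.+1]. *)
have [m [n Dmn]] : exists m n : 'I_3 -> nat,
    forall i, (m i)%:R - (n i)%:R = d%:R * u 0 i.
  exists (fun i => if z i is Posz n then n else 0%N).
  exists (fun i => if z i is Negz n then n.+1 else 0%N) => i.
  rewrite Dzi; case: (z i) => k; first by rewrite subr0.
  by rewrite sub0r NegzE mulrNz.
have mn i : m i = n i.
  apply: v_indep; apply: coord_inj => j.
  rewrite !(big_morph _ (coordD j) (coord0 j)); apply/eqP; rewrite -subr_eq0 -sumrB.
  have /rowP/(_ j) := congr1 ( *:%R d%:R) uA; rewrite scaler0 !mxE mulr_sumr => D.
  apply/eqP; rewrite -[RHS]D; apply: eq_bigr => k _.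
  rewrite mxE mulrA -Dmn !coordD !coordMn.
  move: (coord j _) (coord j _) => a b.
  by rewrite -!(mulr_natr a) -!(mulr_natr b); ring.
case/eqP: u0; apply/rowP=> i; rewrite mxE; apply/eqP.
have := Dmn i; rewrite mn subrr => /esym/eqP.
by rewrite mulf_eq0 pnatr_eq0 -leqn0 leqNgt d_gt0.
Qed.

End Grams.

(** * Divisors of x^(1, 0) + x^(0, 1) - 1 *)

Section MonoidAlgebra.

Variables (F : fieldType) (p : nat).
Hypothesis p_pr : prime p.
Notation M := (grams p * grams p)%type.
Notation R := {poly {poly F}}.
Implicit Types (f g h : malg F M) (u v : M).

Lemma malg_mulE f g s :
  malg_mul f g s = \sum_(u <- finsupp f) \sum_(v <- finsupp g)
                      (if u + v == s then f u * g v else 0).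
Proof.
rewrite fsfunE; case: ifPn => // s_notin; symmetry.
rewrite big_seq big1 // => u uf; rewrite big_seq big1 // => v vg.
case: eqP => // uvs; case/negP: s_notin; rewrite -uvs.
by apply/imfset2P; exists u => //; exists v.
Qed.

(** * Passage from the monoid algebra to F[X][Y] by a common denominator of the exponents *)

Definition lattice N : pred M := fun u =>
  [forall j, N%:R * coord j u \is a Num.nat].

(* Truncation only matters, as junk, outside of lattice N. *)
Definition scaled_coord N j u := Num.truncn (N%:R * coord j u).

Definition monomial N u : R :=
  'X%:P ^+ scaled_coord N 0 u * 'X^(scaled_coord N 1 u).

(** X and Y stand for x^(1/N, 0) and x^(0, 1/N), whose exponents need not lie in [M]. For positive
    [N] this embeds the elements supported on [lattice N], in general not onto F[X][Y]. *)
Definition to_poly N g : R := \sum_(u <- finsupp g) (g u)%:P%:P * monomial N u.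

Definition supported N g := {subset finsupp g <= lattice N}.

Lemma latticeP N u :
  reflect (forall j, N%:R * coord j u \is a Num.nat) (u \in lattice N).
Proof. exact: forallP. Qed.

Lemma scaled_coordK N j u :
  u \in lattice N -> (scaled_coord N j u)%:R = N%:R * coord j u.
Proof. by move=> /latticeP /(_ j) /truncnK. Qed.

Lemma lattice0 N : 0 \in lattice N.
Proof. by apply/latticeP=> j; rewrite coord0 mulr0. Qed.

Lemma latticeD N u v : u \in lattice N -> v \in lattice N -> u + v \in lattice N.
Proof.
move=> /latticeP uN /latticeP vN; apply/latticeP=> j.
by rewrite coordD mulrDr rpredD.
Qed.

Lemma lattice_mull N m : {subset lattice N <= lattice (m * N)}.
Proof.
move=> u /latticeP uN; apply/latticeP=> j.
by rewrite natrM -mulrA rpredM ?natr_nat ?uN.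
Qed.

Lemma supported_mull N m g : supported N g -> supported (m * N) g.
Proof. by move=> gN u /gN /lattice_mull. Qed.

Lemma monomialD N u v : u \in lattice N -> v \in lattice N ->
  monomial N (u + v) = monomial N u * monomial N v.
Proof.
move=> uN vN; have uvD j :
    scaled_coord N j (u + v) = (scaled_coord N j u + scaled_coord N j v)%N.
  apply/eqP; rewrite -(eqr_nat rat) natrD !scaled_coordK ?latticeD //.
  by rewrite coordD mulrDr.
by rewrite /monomial !uvD !exprD mulrACA.
Qed.

Lemma to_poly_sub N g (A : {fset M}) : (finsupp g `<=` A)%fset ->
  to_poly N g = \sum_(u <- A) (g u)%:P%:P * monomial N u.
Proof.
move=> gA; apply: big_fset_incl gA _ => u _ /fsfun_dflt ->.
by rewrite !polyC0 mul0r.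
Qed.

Lemma supported_mul N f g :
  supported N f -> supported N g -> supported N (malg_mul f g).
Proof.
move=> fN gN s; rewrite mem_finsupp malg_mulE => nz.
have [u uf [v vg <-]] : exists2 u, u \in finsupp f &
    exists2 v, v \in finsupp g & u + v = s.
  apply: contrapT => no; case/eqP: nz.
  rewrite big_seq big1 // => u uf; rewrite big_seq big1 // => v vg.
  by case: eqP => // uvs; case: no; exists u => //; exists v.
exact: latticeD (fN _ uf) (gN _ vg).
Qed.

(** After exchanging the sums, a pair [u], [v] contributes only at the exponent [u + v], where
    [monomialD] applies. *)
Lemma to_polyM N f g : supported N f -> supported N g ->
  to_poly N (malg_mul f g) = to_poly N f * to_poly N g.
Proof.
move=> fN gN.
pose A := [fset (u + v)%R | u in finsupp f, v in finsupp g]%fset.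
have sA : (finsupp (malg_mul f g) `<=` A)%fset.
  by apply/fsubsetP=> s; rewrite mem_finsupp fsfunE; case: ifP; rewrite ?eqxx.
rewrite (to_poly_sub N sA) /to_poly mulr_suml.
under eq_bigr => s _ do rewrite malg_mulE !rmorph_sum /= mulr_suml.
rewrite exchange_big /= big_seq [RHS]big_seq; apply: eq_bigr => u uf.
rewrite mulr_sumr.
under eq_bigr => s _ do rewrite !rmorph_sum /= mulr_suml.
rewrite exchange_big /= big_seq [RHS]big_seq; apply: eq_bigr => v vg.
have uvA : u + v \in A by apply/imfset2P; exists u => //; exists v.
rewrite (big_fsetD1 _ uvA) /= eqxx big_seq big1 => [|s]; last first.
  by rewrite !inE eq_sym => /andP [/negPf -> _]; rewrite !polyC0 mul0r.
by rewrite addr0 (monomialD (fN _ uf) (gN _ vg)) !rmorphM mulrACA.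
Qed.

(** Distinct lattice points have distinct scaled coordinates, so a single exponent contributes to
    each coefficient. *)
Lemma to_poly_coef N g u : (0 < N)%N -> supported N g -> u \in lattice N ->
  (to_poly N g)`_(scaled_coord N 1 u)`_(scaled_coord N 0 u) = g u.
Proof.
move=> N_gt0 gN uN; have N0 : N%:R != 0 :> rat by rewrite pnatr_eq0 -lt0n.
have coef v :
    ((g v)%:P%:P * monomial N v)`_(scaled_coord N 1 u)`_(scaled_coord N 0 u) =
    g v *+ ((scaled_coord N 0 u == scaled_coord N 0 v) &&
            (scaled_coord N 1 u == scaled_coord N 1 v)).
  rewrite coefCM /monomial -polyC_exp coefCM coefXn coefCM.
  case: eqP => _; rewrite ?mulr1 ?mulr0 ?coefXn ?coef0 ?andbF ?mulr0 ?andbT //.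
  by case: eqP; rewrite ?mulr1 ?mulr0.
(* Adjoining [u] to the index set treats [u] inside and outside the support alike. *)
have sU : (finsupp g `<=` u |` finsupp g)%fset by apply: fsubsetUr.
rewrite (to_poly_sub N sU) coef_sum coef_sum (big_fsetD1 u) ?fset1U1 //=.
rewrite coef !eqxx big_seq big1 ?addr0 // => v; rewrite !inE => /andP [v_u vg].
have vN : v \in lattice N by move: vg; rewrite (negPf v_u) => /gN.
rewrite coef; case: andP => // [] [/eqP e0 /eqP e1]; case/eqP: v_u.
apply: coord_inj => j; apply: (mulfI N0); rewrite -!scaled_coordK //.
case: (unliftP ord0 j) => [i ->|->]; rewrite ?ord1 ?e0 //.
by rewrite (_ : lift _ _ = 1) ?e1 //; apply: val_inj.
Qed.

Lemma to_poly_inj N f g : (0 < N)%N -> supported N f -> supported N g ->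
  to_poly N f = to_poly N g -> f = g.
Proof.
move=> N_gt0 fN gN fg; apply/fsfunP => u.
have [uN|uN] := boolP (u \in lattice N).
  by rewrite -(to_poly_coef N_gt0 fN uN) fg to_poly_coef.
rewrite !fsfun_dflt //; first exact: contra (gN u) uN.
exact: contra (fN u) uN.
Qed.

Lemma ex_supported f : exists2 N, (0 < N)%N & supported N f.
Proof.
have [N N_gt0 DN] := rat_common_denom
  (fun a : finsupp f * 'I_2 => coord a.2 (val a.1)).
exists N => // u uf; apply/latticeP=> j; have [/= z Dz] := DN ([` uf]%fset, j).
have : 0 <= N%:R * coord j u by rewrite mulr_ge0 ?coord_ge0.
by rewrite Dz ler0z; case: z {Dz} => // n _; apply: natr_nat.
Qed.

(** * Constants, powers and the elements c f_k^j, with identities checked in F[X][Y] *)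

Definition malgC (c : F) : malg F M := [fsfun s in [fset (0 : M)]%fset => c | 0].

Lemma malgC_supp c : (finsupp (malgC c) `<=` [fset (0 : M)])%fset.
Proof. exact: finsupp_sub. Qed.

Lemma supportedC N c : supported N (malgC c).
Proof.
by move=> u /(fsubsetP (malgC_supp c)); rewrite inE => /eqP ->; apply: lattice0.
Qed.

Lemma monomial0 N : monomial N 0 = 1.
Proof.
by rewrite /monomial /scaled_coord !coord0 mulr0 truncn0 !expr0 mulr1.
Qed.

Lemma to_polyC N c : to_poly N (malgC c) = c%:P%:P.
Proof.
rewrite (to_poly_sub N (malgC_supp c)) big_seq_fset1 monomial0 mulr1.
by rewrite fsfunE inE eqxx.
Qed.

Lemma to_poly1 N : to_poly N (malg_one F M) = 1.
Proof. exact: to_polyC. Qed.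

Definition malgX f n := iter n (malg_mul f) (malg_one F M).

Lemma supportedX N f n : supported N f -> supported N (malgX f n).
Proof.
by move=> fN; elim: n => [|n IHn]; [apply: supportedC | apply: supported_mul].
Qed.

Lemma to_polyX N f n : supported N f -> to_poly N (malgX f n) = to_poly N f ^+ n.
Proof.
move=> fN; elim: n => [|n IHn]; first exact: to_poly1.
by rewrite exprS -IHn -to_polyM //; apply: supportedX.
Qed.

(* f_k *)
Definition fermat_root k : malg F M :=
  [fsfun s in [fset (pinv p_pr k, 0); (0, pinv p_pr k); 0]%fset =>
     if s == 0 then -1 else 1 | 0].

Lemma val_pinv_gt0 k : 0 < val (pinv p_pr k).
Proof. by rewrite /= invr_gt0 ltr0n expn_gt0 prime_gt0. Qed.

Lemma mulr_pinv m k : (m * p ^ k)%:R * val (pinv p_pr k) = m%:R.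
Proof.
rewrite natrM /= mulfK //.
by rewrite pnatr_eq0 -lt0n expn_gt0 prime_gt0.
Qed.

Lemma pinv_neq0 k : pinv p_pr k != 0.
Proof.
by apply/eqP=> /(congr1 val) /eqP; rewrite raddf0 gt_eqF ?val_pinv_gt0.
Qed.

Lemma supported_fermat_root m k : supported (m * p ^ k) (fermat_root k).
Proof.
move=> u /(fsubsetP (finsupp_sub _ _ _)); rewrite !inE.
case/orP=> [/orP [] /eqP -> |/eqP ->]; last exact: lattice0.
- apply/latticeP=> j; rewrite /coord; case: ifP => _.
    by rewrite mulr_pinv natr_nat.
  by rewrite raddf0 mulr0.
- apply/latticeP=> j; rewrite /coord; case: ifP => _.
    by rewrite raddf0 mulr0.
  by rewrite mulr_pinv natr_nat.
Qed.

(** Scaling by [m * p ^ k] turns the exponent 1/p^k into [m]. *)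
Lemma to_poly_fermat_root m k : to_poly (m * p ^ k) (fermat_root k) = fermat F m.
Proof.
have sA := finsupp_sub _ _ _ : (finsupp (fermat_root k) `<=` _)%fset.
have t_neq0 := pinv_neq0 k.
have neq : ((0, pinv p_pr k) == (pinv p_pr k, 0) :> M) = false.
  by rewrite xpair_eqE eq_sym (negPf t_neq0).
have neq1 : ((pinv p_pr k, 0) == 0 :> M) = false.
  by rewrite [LHS]xpair_eqE (negPf t_neq0).
have neq2 : ((0, pinv p_pr k) == 0 :> M) = false.
  by rewrite [LHS]xpair_eqE (negPf t_neq0) andbF.
rewrite (to_poly_sub _ sA) fsetUC big_fsetU1 ?inE 1?eq_sym ?neq1 1?eq_sym ?neq2 //=.
rewrite big_fsetU1 ?inE 1?eq_sym ?neq //= big_seq_fset1 !fsfunE !inE !eqxx ?orbT /=.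
rewrite neq1 neq2 monomial0 /monomial /scaled_coord /coord /=.
have -> : (m * p ^ k)%:R / (p ^ k)%:R = m%:R :> rat := mulr_pinv m k.
rewrite !mulr0 truncn0 natrK !expr0 !mul1r !mulr1 -polyC_exp /fermat.
by rewrite !rmorphB !rmorphN !rmorph1 addrC -addrA addrCA.
Qed.

(* c f_k^j *)
Definition fermat_elt c k j : malg F M := malg_mul (malgC c) (malgX (fermat_root k) j).

Lemma supported_fermat_elt m c k j : supported (m * p ^ k) (fermat_elt c k j).
Proof.
by apply/supported_mul/supportedX/supported_fermat_root; apply: supportedC.
Qed.

Lemma to_poly_fermat_elt m c k j :
  to_poly (m * p ^ k) (fermat_elt c k j) = c%:P%:P * fermat F m ^+ j.
Proof.
have sup := @supported_fermat_root m k.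
rewrite to_polyM ?to_polyC ?to_polyX ?to_poly_fermat_root //.
  exact: supportedC.
exact: supportedX.
Qed.

(** With an inverse supported on [lattice N], the lattice of [N * p ^ k] contains both supports, and
    [fermat F N ^+ j], of positive degree in Y, would divide 1. *)
Lemma fermat_elt_nonunit c k j : (0 < j)%N -> ~ malg_unit (fermat_elt c k j).
Proof.
move=> j_gt0 [h def1]; have [N N_gt0 hN] := ex_supported h.
have pk_gt0 : (0 < p ^ k)%N by rewrite expn_gt0 prime_gt0.
have := congr1 (to_poly (N * p ^ k)) def1.
rewrite to_poly1 to_polyM ?to_poly_fermat_elt; first last.
- by rewrite mulnC; apply: supported_mull.
- exact: supported_fermat_elt.
rewrite mulrAC => D1; have : fermat F N ^+ j %| 1 by rewrite -D1 dvdp_mulIr.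
rewrite dvdp1 => /eqP sz1; have := size_exp (fermat F N) j.
rewrite sz1 size_fermat //= => /esym/eqP.
by rewrite muln_eq0 !eqn0Ngt N_gt0 j_gt0.
Qed.

(** As f_k is the p-th power of f_(k+1), one factor f_(k+1) splits off. With denominator p^(k+1),
    f_k becomes [fermat F p] and f_(k+1) becomes [fermat F 1]. *)
Lemma fermat_elt_split c k i j : p \in [pchar F] -> i.+1 = (p * j)%N ->
  fermat_elt c k j = malg_mul (fermat_elt c k.+1 1) (fermat_elt 1 k.+1 i).
Proof.
move=> pF Dij; have N_gt0 : (0 < p * p ^ k)%N.
  by rewrite muln_gt0 expn_gt0 prime_gt0.
have D : (p * p ^ k = 1 * p ^ k.+1)%N by rewrite mul1n expnS.
have sup c' i' : supported (p * p ^ k) (fermat_elt c' k.+1 i').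
  by rewrite D; apply: supported_fermat_elt.
apply: (to_poly_inj N_gt0); first exact: supported_fermat_elt.
  exact: supported_mul.
rewrite to_polyM // to_poly_fermat_elt D !to_poly_fermat_elt.
by rewrite !rmorph1 mul1r -mulrA -exprD add1n Dij exprM -(fermat_pchar 1 pF) mul1n.
Qed.

Lemma fermat_elt_divisor g h : p \in [pchar F] -> malg_mul g h = fermat_elt 1 0 1 ->
  exists c k j, c != 0 /\ g = fermat_elt c k j.
Proof.
move=> pF Dgh; have [N1 N1_gt0 gN1] := ex_supported g.
have [N2 N2_gt0 hN2] := ex_supported h; pose N := (N1 * N2)%N.
have N_gt0 : (0 < N)%N by rewrite muln_gt0 N1_gt0.
have gN : supported N g by rewrite /N mulnC; apply: supported_mull.
have hN : supported N h by apply: supported_mull.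
(* The part [m] prime to [p] is nonzero in [F], as irreducibility of [fermat F m] demands; the
   exponent [k] of [p] selects the root f_k. *)
have [m pm DN] := pfactor_coprime p_pr N_gt0; set k := logn p N in DN.
have mF : m%:R != 0 :> F by rewrite -(dvdn_pcharf pF) -prime_coprime.
have := congr1 (to_poly N) Dgh.
(* [N * 1] is read as [N * p ^ 0], so that f_0 becomes [fermat F N]. *)
rewrite to_polyM // -[N in RHS]muln1 (to_poly_fermat_elt N 1 0 1).
rewrite rmorph1 mul1r expr1.
rewrite {3}DN fermat_pchar_exp // => /(dvd_fermat_exp mF) [c [j [c0 Dg]]].
exists c, k, j; split=> //; apply: (to_poly_inj N_gt0 gN).
  by rewrite DN; apply: supported_fermat_elt.
by rewrite Dg {1}DN to_poly_fermat_elt.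
Qed.

Lemma malgC_unit c : c != 0 -> malg_unit (malgC c).
Proof.
move=> c0; exists (malgC c^-1); apply: (@to_poly_inj 1) => //.
- by apply: supported_mul; apply: supportedC.
- exact: supportedC.
rewrite to_polyM; try exact: supportedC.
by rewrite !to_polyC -!rmorphM mulfV.
Qed.

Lemma fermat_elt0 c k : fermat_elt c k 0 = malgC c.
Proof.
apply: (@to_poly_inj 1) => //; try exact: supportedC.
  by apply: supported_mul; apply: supportedC.
rewrite to_polyM; try exact: supportedC.
by rewrite [X in _ * X]to_poly1 mulr1.
Qed.

Lemma fermat_elt_reducible c k j : p \in [pchar F] -> c != 0 ->
  ~ malg_irreducible (fermat_elt c k j).
Proof.
move=> pF c0; case: j => [|j] [_ [nonunit irr]].
  by apply: nonunit; rewrite fermat_elt0; apply: malgC_unit.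
(* The exponent [p * j.+1] of f_(k+1) is at least 2, so after splitting off one factor both parts
   are nonunits. *)
have := leq_trans (prime_gt1 p_pr) (leq_pmulr p (ltn0Sn j)).
case Di: (p * j.+1)%N => [|[|i]] // _.
have := irr _ _ (fermat_elt_split c k pF (esym Di)).
by case; apply: fermat_elt_nonunit.
Qed.

Lemma grams2_malg_not_atomic : p \in [pchar F] -> ~ malg_atomic F M.
Proof.
move=> pF atomicF; have nonunit := @fermat_elt_nonunit 1 0 1 isT.
have [|[|g s] [irr Ds]] := atomicF (fermat_elt 1 0 1) _ nonunit.
- move=> D0; have := to_poly_fermat_elt 1 1 0 1.
  rewrite D0 /to_poly big1 => [/esym/eqP|u _]; last first.
    by rewrite fsfunE inE !rmorph0 mul0r.
  by rewrite rmorph1 mul1r expr1 -size_poly_eq0 size_fermat.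
(* An empty factorization would make f_0 equal to 1. *)
- by apply: nonunit; rewrite Ds; apply: malgC_unit; apply: oner_neq0.
(* The first factor [g] divides f_0 with the remaining product as cofactor, which already
   contradicts its irreducibility. *)
have [c [k [j [c0 Dg]]]] := fermat_elt_divisor pF (esym Ds).
apply: (@fermat_elt_reducible c k j pF c0); rewrite -Dg.
by apply: irr; rewrite mem_head.
Qed.

End MonoidAlgebra.

Theorem theorem4p3 (F : fieldType) (p : nat) (hp : p \in [pchar F]%R) :
  exists M : nmodType,
    mcancellative M /\ mtorsion_free M /\ matomic M /\ has_rank M 2 /\
    ~ malg_atomic F M.
Proof.
have p_pr := pcharf_prime hp; exists (grams p * grams p)%type.
split; first exact: grams2_cancellative.
split; first exact: grams2_torsion_free.
split; first exact: grams2_atomic.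
by split; [exact: grams2_rank | exact: grams2_malg_not_atomic].
Qed.
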